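(* Let $(G,J_G)$ and $(M,J_M)$ be a matched pair of almost groups with actions $\triangleright,\triangleleft$. Then the set $G\times M$ with the binary operation $$(u,s)(v,t)=\big(u(s\triangleright v),\,(s\triangleleft v)t\big),$$ the map $(u,s)^i=(s^i\triangleright u^i,\ s^i\triangleleft u^i)$, and the subset $J_{G\bowtie M}=J_G\times J_M$, is an almost group (the doublecross product $G\bowtie M$).
   Context: **Almost group.** An almost group $(G,J)$ is a set $G$ with an associative binary operation, a bijection $i:G\to G$, $g\mapsto g^i$, and a subset $J\subset G$ closed under the binary operation and under $i$, such that: $(gh)^i=h^ig^i$ for all $g,h\in G$; $jg=gj$ for all $g\in G$, $j\in J$; $gg^i=g^ig\in J$ for all $g\in G$; $(g^i)^i=g$ for all $g\in G$. **Matched pair.** A matched pair of almost groups $(G,J_G)$, $(M,J_M)$ consists of functions $\triangleright:M\times G\to G$ and $\triangleleft:M\times G\to M$ such that for all $s,t\in M$, $u,v\in G$: $s\triangleleft uv=(s\triangleleft u)\triangleleft v$; $st\triangleleft u=(s\triangleleft(t\triangleright u))(t\triangleleft u)$; $st\triangleright u=s\triangleright(t\triangleright u)$; $s\triangleright uv=(s\triangleright u)((s\triangleleft u)\triangleright v)$; $(s\triangleleft u)^i\triangleright(s\triangleright u)^i=u^i$; $(s\triangleleft u)^i\triangleleft(s\triangleright u)^i=s^i$; $j\triangleright u=u$ and $j\triangleleft u=j$ for all $j\in J_M$; $s\triangleright j=j$ and $s\triangleleft j=s$ for all $j\in J_G$. *)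

(* Defs.v *)
From mathcomp Require Import all_boot classical_sets.

Set Implicit Arguments.
Unset Strict Implicit.
Unset Printing Implicit Defensive.

Local Open Scope classical_set_scope.

Record is_almost_group (G : Type) (mul : G -> G -> G) (inv : G -> G)
    (J : set G) : Prop := IsAlmostGroup {
  ag_mulA : associative mul ;
  ag_inv_bij : bijective inv ;
  ag_J_mul : forall j k, J j -> J k -> J (mul j k) ;
  ag_J_inv : forall j, J j -> J (inv j) ;
  ag_invM : forall g h, inv (mul g h) = mul (inv h) (inv g) ;
  ag_J_central : forall g j, J j -> mul j g = mul g j ;
  ag_mul_inv_comm : forall g, mul g (inv g) = mul (inv g) g ;
  ag_mul_inv_J : forall g, J (mul g (inv g)) ;
  ag_invK : forall g, inv (inv g) = g
}.

Section MatchedPair.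

Variables (G : Type) (mulG : G -> G -> G) (invG : G -> G) (JG : set G).
Variables (M : Type) (mulM : M -> M -> M) (invM : M -> M) (JM : set M).
Variables (actl : M -> G -> G) (actr : M -> G -> M).

Local Notation "s |> u" := (actl s u) (at level 30, no associativity).
Local Notation "s <| u" := (actr s u) (at level 30, no associativity).

Record is_matched_pair : Prop := IsMatchedPair {
  mp_actrM : forall s u v, s <| (mulG u v) = (s <| u) <| v ;
  mp_actr_mul : forall s t u,
    (mulM s t) <| u = mulM (s <| (t |> u)) (t <| u) ;
  mp_actlM : forall s t u, (mulM s t) |> u = s |> (t |> u) ;
  mp_actl_mul : forall s u v,
    s |> (mulG u v) = mulG (s |> u) ((s <| u) |> v) ;
  mp_actl_inv : forall s u, invM (s <| u) |> invG (s |> u) = invG u ;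
  mp_actr_inv : forall s u, invM (s <| u) <| invG (s |> u) = invM s ;
  mp_JM_actl : forall j u, JM j -> j |> u = u ;
  mp_JM_actr : forall j u, JM j -> j <| u = j ;
  mp_JG_actl : forall s j, JG j -> s |> j = j ;
  mp_JG_actr : forall s j, JG j -> s <| j = s
}.

Definition doublecross_mul (x y : G * M) : G * M :=
  (mulG x.1 (x.2 |> y.1), mulM (x.2 <| y.1) y.2).

Definition doublecross_inv (x : G * M) : G * M :=
  (invM x.2 |> invG x.1, invM x.2 <| invG x.1).

End MatchedPair.

(* Main.v *)
Require Import Defs.
From mathcomp Require Import all_boot classical_sets.

Local Open Scope classical_set_scope.

(** Associativity is the four composition laws of the matched pair plus associativity in each
    factor. The two laws relating the actions to the inversions make the new [i] an involution,
    hence bijective, and reverse products. Elements of [JM] and [JG] act trivially and are fixed, so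
    on [JG] times [JM] everything is componentwise; [mul_inv] shows that [x] times its inverse is
    componentwise too. *)

Theorem proposition4p2
  (G : Type) (mulG : G -> G -> G) (invG : G -> G) (JG : set G)
  (M : Type) (mulM : M -> M -> M) (invM : M -> M) (JM : set M)
  (actl : M -> G -> G) (actr : M -> G -> M)
  (hG : is_almost_group mulG invG JG)
  (hM : is_almost_group mulM invM JM)
  (hGM : is_matched_pair mulG invG JG mulM invM JM actl actr) :
  is_almost_group (doublecross_mul mulG mulM actl actr)
                  (doublecross_inv invG invM actl actr)
                  (JG `*` JM).
Proof.
have [mulGA _ JG_mul JG_inv invGM JG_central mulG_inv_comm mulG_inv_J invGK] := hG.
have [mulMA _ JM_mul JM_inv invMM JM_central mulM_inv_comm mulM_inv_J invMK] := hM.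
have [actrM actr_mul actlM actl_mul actl_inv actr_inv
      JM_actl JM_actr JG_actl JG_actr] := hGM.
have mul_inv (x : G * M) :
    doublecross_mul mulG mulM actl actr x (doublecross_inv invG invM actl actr x)
    = (mulG x.1 (invG x.1), mulM x.2 (invM x.2)).
  (* Both actions on [invG x.1] recombine into that of [mulM x.2 (invM x.2)], which lies in [JM]. *)
  by rewrite /doublecross_mul /= -actlM -actr_mul JM_actl ?JM_actr.
have invK : involutive (doublecross_inv invG invM actl actr).
  by move=> [u s]; rewrite /doublecross_inv /= actl_inv actr_inv invGK invMK.
split=> //.
- move=> [u s] [v t] [w r]; rewrite /doublecross_mul /=.
  by rewrite actl_mul actlM actrM actr_mul mulGA mulMA.
- exact: inv_bij.
- move=> [j j'] [k k'] [/= Jj Jj'] [/= Jk Jk']; rewrite /doublecross_mul /=.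
  by rewrite JM_actl // JG_actr //; split; [exact: JG_mul | exact: JM_mul].
- move=> [j j'] [/= Jj Jj']; rewrite /doublecross_inv /=.
  have Jji := JG_inv _ Jj.
  by rewrite JG_actl // JG_actr //; split; [|exact: JM_inv].
- move=> [u s] [v t]; rewrite /doublecross_mul /doublecross_inv /=.
  rewrite invMM invGM; congr pair.
    (* The inverse of [actr s v], acting on the inverse of [actl s v], collapses to [invG v] and
       leaves [invM s] to act on [invG u]. *)
    by rewrite actlM actl_mul actl_inv actr_inv actl_mul.
  by rewrite actrM actr_mul actl_inv actr_inv actr_mul.
- move=> [u s] [j k] [/= Jj Jk]; rewrite /doublecross_mul /=.
  by rewrite JM_actl // JM_actr // JG_actl // JG_actr // JG_central // JM_central.
- move=> [u s]; rewrite mul_inv /doublecross_mul /=.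
  (* Here [invM s] meets [mulG (invG u) u], whose membership in [JG] is known only after swapping
     the factors. *)
  by rewrite -actl_mul -actrM -mulG_inv_comm JG_actl // JG_actr // mulM_inv_comm.
- by move=> x; rewrite mul_inv; split; [exact: mulG_inv_J | exact: mulM_inv_J].
Qed.
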